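(* Let $n\ge1$, $z=(z_1,\dots,z_n)$, $t$ a formal parameter. For any $Q_t(z)\in\mathbb{C}[[z,t]]$ with $o(Q_t(z))\ge2$ and $P(z)\in\mathbb{C}[[z]]$ with $o(P(z))\ge2$, the following are equivalent. (1) $G_t(z)=z+t\nabla Q_t(z)$ is the formal inverse of $F_t(z)=z-t\nabla P(z)$. (2) $Q_t(z)$ is the unique power series solution (in $z$ and $t$) of the Cauchy problem $$\frac{\partial Q_t(z)}{\partial t}=\frac12\langle\nabla Q_t,\nabla Q_t\rangle,\qquad Q_{t=0}(z)=P(z).$$
   Context: $\nabla$ is the gradient with respect to $z$ (a column vector); $\langle a,b\rangle=\sum_i a_ib_i$ is the standard $\mathbb{C}$-bilinear form. The order $o(\cdot)$ is the order in $z$, i.e. the lowest total degree in $z$ of a monomial that occurs (with $o(0)=\infty$). Composition of formal maps is in the variables $z$ with $t$ treated as a constant; $G_t$ is the formal inverse of $F_t$ if $F_t(G_t(z))=z=G_t(F_t(z))$. ''Power series solution'' means a solution in $\mathbb{C}[[z,t]]$. *)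

(* Defs.v *)
From HB Require Import structures.
From mathcomp Require Import all_boot all_order all_algebra.
From mathcomp Require Import boolp reals.
From mathcomp Require Import complex mpoly.

Set Implicit Arguments.
Unset Strict Implicit.
Unset Printing Implicit Defensive.

Import GRing.Theory.
Local Open Scope ring_scope.

(* The ring K[[x_0, ..., x_(n-1)]]. Monomials are the multinomials 'X_{1..n}
   of the mpoly library; a series is an arbitrary family of coefficients. *)
Record mpseries (n : nat) (K : Type) := MPSeries
  { mpcoef :> 'X_{1..n} -> K }.

Notation "{ 'mpseries' K [ n ] }" := (mpseries n K)
  (at level 0, K, n at level 2, format "{ 'mpseries'  K [ n ] }") : type_scope.

HB.instance Definition _ n (K : Type) := gen_eqMixin (mpseries n K).
HB.instance Definition _ n (K : Type) := gen_choiceMixin (mpseries n K).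

Lemma mpseriesP n (K : Type) (f g : {mpseries K[n]}) : f =1 g -> f = g.
Proof. by case: f g => [f] [g] /= /funext ->. Qed.

Section Ring.
Context (n : nat) (K : comNzRingType).
Implicit Types (f g h : {mpseries K[n]}) (m : 'X_{1..n}).

Definition mps0 : {mpseries K[n]} := MPSeries (fun=> 0).
Definition mps_opp f : {mpseries K[n]} := MPSeries (fun m => - f m).
Definition mps_add f g : {mpseries K[n]} := MPSeries (fun m => f m + g m).

Lemma mps_addA : associative mps_add.
Proof. by move=> f g h; apply/mpseriesP => m /=; rewrite addrA. Qed.
Lemma mps_addC : commutative mps_add.
Proof. by move=> f g; apply/mpseriesP => m /=; rewrite addrC. Qed.
Lemma mps_add0 : left_id mps0 mps_add.
Proof. by move=> f; apply/mpseriesP => m /=; rewrite add0r. Qed.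
Lemma mps_addN : left_inverse mps0 mps_opp mps_add.
Proof. by move=> f; apply/mpseriesP => m /=; rewrite addNr. Qed.

HB.instance Definition _ :=
  GRing.isZmodule.Build {mpseries K[n]} mps_addA mps_addC mps_add0 mps_addN.

Definition mpsC (c : K) : {mpseries K[n]} :=
  MPSeries (fun m => if m == 0%MM then c else 0).
(* The Cauchy product; the degree bounds only make the index type finite. *)
Definition mps_mul f g : {mpseries K[n]} := MPSeries (fun m =>
  \sum_(k : 'X_{1..n < (mdeg m).+1, (mdeg m).+1} | m == (k.1 + k.2)%MM)
     f k.1 * g k.2).

(* Ring identities reduce to those of {mpoly K[n]}: the coefficients of degree
   less than d of a product only depend on the truncations of its factors. *)
Definition mps_trunc (d : nat) f : {mpoly K[n]} :=
  \sum_(m : 'X_{1..n < d}) (f m *: 'X_[m]).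

Lemma mps_truncE d f m : (mdeg m < d)%N -> (mps_trunc d f)@_m = f m.
Proof. by move=> lt_md; rewrite mcoeff_mpoly. Qed.

Lemma mcoeffM_eq d (p q : {mpoly K[n]}) f g m : (mdeg m < d)%N ->
  (forall k, (mdeg k < d)%N -> p@_k = f k) ->
  (forall k, (mdeg k < d)%N -> q@_k = g k) ->
  (p * q)@_m = mps_mul f g m.
Proof.
move=> lt_md Hp Hq; rewrite mcoeffM /=; apply: eq_bigr => k _.
by rewrite Hp ?Hq //; apply: leq_trans lt_md; apply: bmdeg.
Qed.

Lemma mps_mulA : associative mps_mul.
Proof.
move=> f g h; apply/mpseriesP => m; pose d := (mdeg m).+1.
pose T := mps_trunc d.
have TM f' g' k : (mdeg k < d)%N -> (T f' * T g')@_k = mps_mul f' g' k.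
  by move=> lt_kd; apply: mcoeffM_eq lt_kd _ _ => *; apply: mps_truncE.
rewrite -(@mcoeffM_eq d (T f) (T g * T h)) //; last 2 first.
- exact: mps_truncE.
- by move=> k; apply: TM.
by rewrite mulrA (@mcoeffM_eq d _ _ (mps_mul f g) h) // => k;
  [apply: TM | apply: mps_truncE].
Qed.

Lemma mps_mulC : commutative mps_mul.
Proof.
move=> f g; apply/mpseriesP => m; pose d := (mdeg m).+1.
rewrite -(@mcoeffM_eq d (mps_trunc d f) (mps_trunc d g)) //;
  try exact: mps_truncE.
by rewrite mulrC (@mcoeffM_eq d _ _ g f) //; apply: mps_truncE.
Qed.

Lemma mps_mul1 : left_id (mpsC 1) mps_mul.
Proof.
move=> f; apply/mpseriesP => m; pose d := (mdeg m).+1.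
rewrite -(@mcoeffM_eq d 1 (mps_trunc d f)) //; last exact: mps_truncE.
  by rewrite mul1r mps_truncE.
by move=> k _; rewrite mcoeff1 /=; case: eqP.
Qed.

Lemma mps_mulD : left_distributive mps_mul mps_add.
Proof.
move=> f g h; apply/mpseriesP => m /=; rewrite -big_split /=.
by apply: eq_bigr => k _; rewrite mulrDl.
Qed.

Lemma mps_oner_neq0 : mpsC 1 != mps0.
Proof.
apply/eqP => /(congr1 (fun f : {mpseries K[n]} => f 0%MM)) /=.
by rewrite eqxx => /eqP; rewrite oner_eq0.
Qed.

HB.instance Definition _ := GRing.Zmodule_isComNzRing.Build {mpseries K[n]}
  mps_mulA mps_mulC mps_mul1 mps_mulD mps_oner_neq0.

Definition mps_scale (c : K) f : {mpseries K[n]} := MPSeries (fun m => c * f m).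

Lemma mps_scaleA a b f : mps_scale a (mps_scale b f) = mps_scale (a * b) f.
Proof. by apply/mpseriesP => m /=; rewrite mulrA. Qed.
Lemma mps_scale1 : left_id 1 mps_scale.
Proof. by move=> f; apply/mpseriesP => m /=; rewrite mul1r. Qed.
Lemma mps_scaleDr : right_distributive mps_scale +%R.
Proof. by move=> c f g; apply/mpseriesP => m /=; rewrite mulrDr. Qed.
Lemma mps_scaleDl f : {morph mps_scale^~ f : a b / a + b}.
Proof. by move=> a b; apply/mpseriesP => m /=; rewrite mulrDl. Qed.

HB.instance Definition _ := GRing.Zmodule_isLmodule.Build K {mpseries K[n]}
  mps_scaleA mps_scale1 mps_scaleDr mps_scaleDl.

Definition mpsX (i : 'I_n) : {mpseries K[n]} :=
  MPSeries (fun m => (m == U_(i)%MM)%:R).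

Definition mps_deriv (i : 'I_n) f : {mpseries K[n]} :=
  MPSeries (fun m => f (m + U_(i))%MM *+ (m i).+1).

(* The lowest weight, for w, of a monomial occurring in f; None is infinity. *)
Definition mps_order (w : 'X_{1..n} -> nat) f : option nat :=
  if pselect (exists d, `[< exists m, w m = d /\ f m != 0 >]) is left ex_d
  then Some (ex_minn ex_d) else None.

Definition leq_order (d : nat) (o : option nat) : bool :=
  if o is Some e then (d <= e)%N else true.

Lemma leq_mps_orderP w d f :
  leq_order d (mps_order w f) <-> (forall m, (w m < d)%N -> f m = 0).
Proof.
rewrite /mps_order; case: pselect => [ex_d|nex] /=; last first.
  split=> // _ m _; have [//|nz] := eqVneq (f m) 0; case: nex.
  by exists (w m); apply/asboolP; exists m.
case: ex_minnP => e /asboolP[m [wm nz]] min_e; split=> [le_de m' lt|H].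
  have [//|nz'] := eqVneq (f m') 0.
  have : (e <= w m')%N by apply: min_e; apply/asboolP; exists m'.
  by move/(leq_trans le_de); rewrite leqNgt lt.
by rewrite leqNgt; apply/negP; rewrite -wm => /H/eqP; apply/negP.
Qed.

End Ring.

Arguments mpsX {n K} i.

(* The substitution f(h_0, ..., h_(k-1)), meaningful when every h_i has zero
   constant term: then h^a has no term of degree less than |a|, so that the
   coefficient at m of sum_a f_a h^a only involves the a with |a| <= |m|. *)
Definition mps_comp (K : comNzRingType) (k l : nat) (f : {mpseries K[k]})
    (h : 'I_k -> {mpseries K[l]}) : {mpseries K[l]} := MPSeries (fun m =>
  \sum_(a : 'X_{1..k < (mdeg m).+1})
     f a * (\prod_(i < k) h i ^+ (a : 'X_{1..k}) i) m).

(* K[[z,t]] is {mpseries K[n.+1]}: the variable z_i has index lift ord_max i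
   and t has index ord_max. *)
Definition zt_fun (n : nat) (T : Type) (u : 'I_n -> T) (x : T) (j : 'I_n.+1) :
  T := oapp u x (unlift ord_max j).

Definition zmnm (n : nat) (m : 'X_{1..n.+1}) : 'X_{1..n} :=
  [multinom m (lift ord_max i) | i < n].

Definition zdeg (n : nat) (m : 'X_{1..n.+1}) : nat := mdeg (zmnm m).

Section ZT.
Context (n : nat) (K : comNzRingType).
Implicit Types (P : {mpseries K[n]}) (Q f : {mpseries K[n.+1]}).
Implicit Types (u v F G : 'cV[{mpseries K[n.+1]}]_n).

Definition tvar : {mpseries K[n.+1]} := mpsX ord_max.
Definition zvec : 'cV[{mpseries K[n.+1]}]_n := \col_i mpsX (lift ord_max i).

(* The inclusion of K[[z]] into K[[z,t]]. *)
Definition of_z P : {mpseries K[n.+1]} :=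
  MPSeries (fun m => if m ord_max == 0%N then P (zmnm m) else 0).

Definition at_t0 Q : {mpseries K[n]} :=
  MPSeries (fun m => Q [multinom zt_fun m 0%N j | j < n.+1]).

Definition deriv_t Q : {mpseries K[n.+1]} := mps_deriv ord_max Q.

Definition grad_z Q : 'cV[{mpseries K[n.+1]}]_n :=
  \col_i mps_deriv (lift ord_max i) Q.

Definition bilin u v : {mpseries K[n.+1]} := \sum_(i < n) u i 0 * v i 0.

Definition zcomp F G : 'cV[{mpseries K[n.+1]}]_n :=
  \col_i mps_comp (F i 0) (zt_fun (fun j => G j 0) tvar).

Definition zinverse G F : Prop := zcomp F G = zvec /\ zcomp G F = zvec.

End ZT.

Definition cauchy_solution (n : nat) (K : fieldType) (P : {mpseries K[n]})
    (Q : {mpseries K[n.+1]}) : Prop :=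
  deriv_t Q = 2^-1 *: bilin (grad_z Q) (grad_z Q) /\ at_t0 Q = P.

(* Main.v *)
(* Put N = grad Q, M = grad P.  The series z + t N and z - t M are mutually
   inverse exactly when M (z + t N) = N and N (z - t M) = M.  Since the Jacobian
   of N is symmetric, the Cauchy problem for Q is, up to an additive constant,
   the Burgers equation N_t = (DN) N with initial value M.
   If N solves the Burgers equation, then V = N - M (z + t N) satisfies
   V_t = (DV) N and W = N (z - t M) - M satisfies W_t = (DN)(z - t M) W; both
   vanish at t = 0, hence identically, by induction on the order in t.
   Conversely, if V = 0 then X = N_t - (DN) N satisfies
   X = t (DM)(z + t N) X, so X is divisible by every power of t. *)
Require Import Defs.
From HB Require Import structures.
From mathcomp Require Import all_boot all_order all_algebra.
From mathcomp Require Import reals complex mpoly ring.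

Set Implicit Arguments.
Unset Strict Implicit.
Unset Printing Implicit Defensive.

Import GRing.Theory Num.Theory.
Local Open Scope ring_scope.

(** * Coefficients, derivations and vanishing orders *)

Section Coefficients.
Context (n : nat) (K : comNzRingType).
Implicit Types (f g : {mpseries K[n]}) (m : 'X_{1..n}) (w : 'X_{1..n} -> nat).

Lemma mps_sumE (I : Type) (r : seq I) (p : pred I)
    (F : I -> {mpseries K[n]}) m :
  (\sum_(i <- r | p i) F i) m = \sum_(i <- r | p i) F i m.
Proof. by elim/big_rec2: _ => // i _ f _ <-. Qed.

Lemma mpsC_zmod_morphism : zmod_morphism (@mpsC n K).
Proof.
by move=> a b; apply/mpseriesP => m /=; case: eqP => // _; rewrite subrr.
Qed.

HB.instance Definition _ :=
  GRing.isZmodMorphism.Build K {mpseries K[n]} (@mpsC n K) mpsC_zmod_morphism.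

Lemma mps_mul_congr f f' g g' m :
  (forall k, (mdeg k <= mdeg m)%N -> f k = f' k) ->
  (forall k, (mdeg k <= mdeg m)%N -> g k = g' k) ->
  (f * g) m = (f' * g') m.
Proof.
move=> Hf Hg; apply: eq_bigr => k _.
by rewrite Hf ?Hg // -ltnS bmdeg.
Qed.

Lemma mps_truncM d f g m : (mdeg m < d)%N ->
  (mps_trunc d f * mps_trunc d g)@_m = (f * g) m.
Proof. by move=> lt_md; apply: mcoeffM_eq lt_md _ _; apply: mps_truncE. Qed.

(** The identity holds for polynomials and is carried over by truncating above the degree of [m],
    where the product coefficient is already determined. *)
Lemma mpsCM c f m : (mpsC n c * f) m = c * f m.
Proof.
rewrite -(@mps_truncM (mdeg m).+1) //.
transitivity ((c%:MP * mps_trunc (mdeg m).+1 f)@_m).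
  have E k : (mdeg k < (mdeg m).+1)%N -> c%:MP_[n]@_k = mpsC n c k.
    by rewrite mcoeffC /= => _; case: eqP; rewrite ?mulr1 ?mulr0.
  rewrite mps_truncM //; symmetry.
  by apply: mcoeffM_eq; [exact: ltnSn|exact: E|exact: mps_truncE].
by rewrite mcoeffCM mps_truncE.
Qed.

Lemma mpsC_monoid_morphism : monoid_morphism (@mpsC n K).
Proof.
split=> // a b; apply/mpseriesP => m.
by rewrite mpsCM /=; case: eqP => //; rewrite mulr0.
Qed.

HB.instance Definition _ :=
  GRing.isMonoidMorphism.Build K {mpseries K[n]} (@mpsC n K)
    mpsC_monoid_morphism.

Lemma mpsXM i f m : (mpsX i * f) (m + U_(i))%MM = f m.
Proof.
rewrite -(@mps_truncM (mdeg (m + U_(i))%MM).+1) //.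
transitivity (('X_i * mps_trunc (mdeg (m + U_(i))%MM).+1 f)@_(m + U_(i))%MM).
  rewrite mps_truncM //; symmetry; apply: mcoeffM_eq; first exact: ltnSn.
    by move=> k _; rewrite mcoeffX /= eq_sym.
  exact: mps_truncE.
by rewrite mulrC addmC mcoeffMX mps_truncE // mdegD mdeg1 add1n leqW.
Qed.

(** Multiplying by a variable only moves coefficients, so it can be cancelled; this is what permits
    division by [t]. *)
Lemma mpsXMI i f : mpsX i * f = 0 -> f = 0.
Proof. by move=> Xf0; apply/mpseriesP => m; rewrite -(mpsXM i f m) Xf0. Qed.

Lemma mps_deriv_zmod_morphism i : zmod_morphism (@mps_deriv n K i).
Proof. by move=> f g; apply/mpseriesP => m /=; rewrite mulrnBl. Qed.

HB.instance Definition _ i :=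
  GRing.isZmodMorphism.Build {mpseries K[n]} {mpseries K[n]} (@mps_deriv n K i)
    (mps_deriv_zmod_morphism i).

Lemma mps_derivM i f g :
  mps_deriv i (f * g) = mps_deriv i f * g + f * mps_deriv i g.
Proof.
(* A derivative at [m] reads a coefficient of degree [mdeg m + 1], so the truncations must be exact
   up to that degree. *)
apply/mpseriesP => m; pose d := (mdeg m).+2.
have lt_d k : (mdeg k < (mdeg m).+1)%N -> (mdeg (k + U_(i)) < d)%N.
  by rewrite mdegD mdeg1 addn1 /d ltnS.
have TE h k : (mdeg k < (mdeg m).+1)%N -> (mps_trunc d h)@_k = h k.
  by move=> lt_k; rewrite mps_truncE // ltnW.
have DE h k : (mdeg k < (mdeg m).+1)%N ->
    ((mps_trunc d h)^`M(i))@_k = mps_deriv i h k.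
  by move=> lt_k; rewrite mcoeff_deriv mps_truncE //; apply: lt_d.
rewrite -[LHS]/((f * g) (m + U_(i))%MM *+ (m i).+1).
rewrite -(@mps_truncM d) ?lt_d // -mcoeff_deriv mderivM mcoeffD.
congr (_ + _); apply: mcoeffM_eq (ltnSn _) _ _ => k; by [apply: TE | apply: DE].
Qed.

Lemma mps_derivC i j f :
  mps_deriv i (mps_deriv j f) = mps_deriv j (mps_deriv i f).
Proof.
apply/mpseriesP => m /=; have [->//|neq_ij] := eqVneq i j.
rewrite !mnmDE !mnm1E [j == i]eq_sym (negPf neq_ij) !addn0 -!mulrnA mulnC.
by rewrite -!addmA [(U_(i) + _)%MM]addmC.
Qed.

Lemma mps_derivX i j : mps_deriv i (mpsX j) = (i == j)%:R :> {mpseries K[n]}.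
Proof.
apply/mpseriesP => m /=; have [->|neq_ij] := eqVneq i j => /=; last first.
  case: eqP => [/mnmP/(_ i)|_]; last by rewrite mul0rn.
  by rewrite mnmDE !mnm1E eqxx eq_sym (negPf neq_ij) addn1.
have -> : (m + U_(j) == U_(j))%MM = (m == 0%MM).
  by rewrite -{2}[U_(j)%MM]add0m (can_eq (@addmK _ _)).
by case: eqP => [->|_]; rewrite ?mul0rn ?mnm0E.
Qed.

Lemma mps_deriv_mpsC i (c : K) : mps_deriv i (mpsC n c) = 0 :> {mpseries K[n]}.
Proof.
by apply/mpseriesP => m /=; rewrite mnmD_eq0 mnm1_eq0 andbF mul0rn.
Qed.

Lemma mps_derivZ i c f : mps_deriv i (c *: f) = c *: mps_deriv i f.
Proof. by apply/mpseriesP => m /=; rewrite mulrnAr. Qed.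

(** The weight is a parameter because three are used: total degree, degree in [z] and degree in [t].
    For an additive weight these series form an ideal, so the predicate acts as a congruence to
    0. *)
Definition vanish_below w (d : nat) f := forall m, (w m < d)%N -> f m = 0.

Lemma vanish_below0 w d : vanish_below w d 0.
Proof. by []. Qed.

Lemma vanish_belowD w d f g :
  vanish_below w d f -> vanish_below w d g -> vanish_below w d (f + g).
Proof. by move=> Hf Hg m lt_m /=; rewrite Hf ?Hg ?addr0. Qed.

Lemma vanish_belowN w d f : vanish_below w d f -> vanish_below w d (- f).
Proof. by move=> Hf m lt_m /=; rewrite Hf ?oppr0. Qed.

Lemma vanish_belowB w d f g :
  vanish_below w d f -> vanish_below w d g -> vanish_below w d (f - g).
Proof. by move=> Hf Hg; apply/vanish_belowD/vanish_belowN. Qed.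

Lemma vanish_below_sum w d (I : Type) (r : seq I) (p : pred I) F :
  (forall i, p i -> vanish_below w d (F i)) ->
  vanish_below w d (\sum_(i <- r | p i) F i).
Proof.
move=> HF; elim/big_rec: _ => [|i f pi Hf]; first exact: vanish_below0.
exact/vanish_belowD/Hf/HF.
Qed.

Lemma vanish_belowM w (wD : {morph w : a b / (a + b)%MM >-> (a + b)%N})
    d e f g :
  vanish_below w d f -> vanish_below w e g -> vanish_below w (d + e) (f * g).
Proof.
move=> Hf Hg m lt_m; apply: big1 => k /eqP def_m.
(* Weights add, so in each term either the first factor has weight below [d] or the second has
   weight below [e]. *)
case: (ltnP (w k.1) d) => [/Hf->|le_d]; first by rewrite mul0r.
rewrite Hg ?mulr0 // -(ltn_add2l d); apply: leq_ltn_trans lt_m.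
by rewrite (congr1 w def_m) wD leq_add2r.
Qed.

Lemma vanish_belowMl w (wD : {morph w : a b / (a + b)%MM >-> (a + b)%N})
    d f g :
  vanish_below w d g -> vanish_below w d (f * g).
Proof. by move=> Hg; rewrite -[d]add0n; apply: vanish_belowM. Qed.

Lemma vanish_belowMr w (wD : {morph w : a b / (a + b)%MM >-> (a + b)%N})
    d f g :
  vanish_below w d f -> vanish_below w d (f * g).
Proof. by move=> Hf; rewrite mulrC; apply: vanish_belowMl. Qed.

Lemma vanish_belowZ w d c f : vanish_below w d f -> vanish_below w d (c *: f).
Proof. by move=> Hf m lt_m /=; rewrite Hf ?mulr0. Qed.

Lemma vanish_below_mpsX w d i :
  (d <= w U_(i)%MM)%N -> vanish_below w d (mpsX i).
Proof.
by move=> le_d m lt_m /=; case: eqP lt_m => // ->; rewrite ltnNge le_d.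
Qed.

End Coefficients.

(** * Substitution *)

Section Composition.
Context (k l : nat) (K : comNzRingType) (h : 'I_k -> {mpseries K[l]}).
Context (h0 : forall i, vanish_below (@mdeg l) 1 (h i)).
Implicit Types (f g : {mpseries K[k]}) (p q : {mpoly K[k]}).

Local Notation ev := (mmap (@mpsC l K) h).

Lemma vanish_below_mmap1 (a : 'X_{1..k}) :
  vanish_below (@mdeg l) (mdeg a) (mmap1 h a).
Proof.
have wD := mdegD (n := l).
have Hexp i e : vanish_below (@mdeg l) e (h i ^+ e).
  elim: e => [|e IHe]; first by move=> m; rewrite ltn0.
  by rewrite exprS -add1n; apply: vanish_belowM.
rewrite /mmap1 mdegE; apply: (big_rec2 (fun d => vanish_below (@mdeg l) d)).
  by move=> m; rewrite ltn0.
by move=> i d f _ Hf; apply: vanish_belowM.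
Qed.

Lemma vanish_below_mmap d p : (forall a, (mdeg a < d)%N -> p@_a = 0) ->
  vanish_below (@mdeg l) d (ev p).
Proof.
move=> Hp; apply: vanish_below_sum => a _ m lt_md; rewrite mpsCM.
have [/Hp->|le_da] := ltnP (mdeg a) d; first by rewrite mul0r.
by rewrite vanish_below_mmap1 ?mulr0 //; apply: leq_trans le_da.
Qed.

(** Substitution reduces to polynomial evaluation: a polynomial with no monomial of degree at most
    [mdeg m] evaluates, on series without constant term, to a series with zero coefficient at
    [m]. *)
Lemma mps_compE p f m : (forall a, (mdeg a <= mdeg m)%N -> p@_a = f a) ->
  mps_comp f h m = ev p m.
Proof.
move=> Hp; transitivity (ev (mps_trunc (mdeg m).+1 f) m).
  rewrite /mps_trunc raddf_sum mps_sumE /=; apply: eq_bigr => a _.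
  by rewrite mmapZ mmapX mpsCM.
apply/eqP; rewrite -subr_eq0; apply/eqP.
rewrite -[LHS]/((ev _ - ev p) m) -mmapB.
apply: (@vanish_below_mmap (mdeg m).+1) => // a lt_a.
by rewrite mcoeffB mps_truncE // Hp ?subrr.
Qed.

Lemma mps_comp_zmod_morphism : zmod_morphism (fun f => mps_comp f h).
Proof.
move=> f g; apply/mpseriesP => m /=; rewrite -sumrB; apply: eq_bigr => a _.
by rewrite mulrBl.
Qed.

Lemma mps_compB f g : mps_comp (f - g) h = mps_comp f h - mps_comp g h.
Proof. exact: mps_comp_zmod_morphism. Qed.

Lemma mps_comp0 : mps_comp 0 h = 0.
Proof. by rewrite -(subrr 0) mps_compB subrr. Qed.

Lemma mps_compD f g : mps_comp (f + g) h = mps_comp f h + mps_comp g h.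
Proof.
by rewrite -{1}[g]opprK mps_compB -[- g]sub0r mps_compB mps_comp0 sub0r opprK.
Qed.

Lemma mps_comp_sum (I : Type) (r : seq I) (P : pred I) F :
  mps_comp (\sum_(i <- r | P i) F i) h = \sum_(i <- r | P i) mps_comp (F i) h.
Proof. exact: (big_morph (fun f => mps_comp f h) mps_compD mps_comp0). Qed.

Lemma mps_compM f g : mps_comp (f * g) h = mps_comp f h * mps_comp g h.
Proof.
apply/mpseriesP => m; pose T := @mps_trunc k K (mdeg m).+1.
rewrite (@mps_compE (T f * T g)); last by move=> a le_a; rewrite mps_truncM.
rewrite rmorphM; apply: mps_mul_congr => a le_a; symmetry;
  by apply: mps_compE => b le_b; apply/mps_truncE/(leq_trans _ le_a).
Qed.

Lemma mps_compX i : mps_comp (mpsX i) h = h i.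
Proof.
apply/mpseriesP => m; rewrite (@mps_compE 'X_i) ?mmapX ?mmap1U // => a _.
by rewrite mcoeffX eq_sym.
Qed.

(** Chain rule for polynomials: it holds for constants and variables, and the Leibniz rule and
    additivity propagate it to products and sums. *)
Lemma mmap_chain j p :
  mps_deriv j (ev p) = \sum_i ev p^`M(i) * mps_deriv j (h i).
Proof.
pose C p := mps_deriv j (ev p) = \sum_i ev p^`M(i) * mps_deriv j (h i).
have C0 c : C c%:MP.
  rewrite /C mmapC mps_deriv_mpsC big1 // => i _.
  by rewrite mderivC mmap0 mul0r.
have CM q r : C q -> C r -> C (q * r).
  rewrite /C rmorphM mps_derivM => -> ->; rewrite mulr_suml mulr_sumr.
  rewrite -big_split.
  by apply: eq_bigr => i _ /=; rewrite mderivM mmapD !rmorphM; ring.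
have CX i : C 'X_i.
  rewrite /C mmapX mmap1U (bigD1 i) //= big1 => [|i' neq_i].
    rewrite mderivX mnm1E eqxx scale1r -{1}[U_(i)%MM]add0m addmK.
    by rewrite mpolyX0 rmorph1 mul1r addr0.
  by rewrite mderivX mnm1E eq_sym (negPf neq_i) scale0r mmap0 mul0r.
elim/mpolyind: p => [|c m p _ _ IHp]; first exact: (C0 0).
rewrite -mul_mpolyC; suff Cm : C (c%:MP * 'X_[m]).
  rewrite mmapD raddfD /= Cm IHp -big_split; apply: eq_bigr => i _ /=.
  by rewrite mderivD mmapD mulrDl.
apply: (CM) => //; rewrite mpolyXE_id.
elim/big_ind: _ => [||i _]; [exact: (C0 1) | exact: (CM) |].
by elim: (m i) => [|e IHe]; [exact: (C0 1) | rewrite exprS; apply: (CM)].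
Qed.

Lemma mps_comp_chain j f :
  mps_deriv j (mps_comp f h) =
  \sum_i mps_comp (mps_deriv i f) h * mps_deriv j (h i).
Proof.
apply/mpseriesP => m; pose d := (mdeg m).+2; pose p := mps_trunc d f.
have ltS a i : (mdeg a <= mdeg m)%N -> (mdeg (a + U_(i)) < d)%N.
  by rewrite mdegD mdeg1 addn1 /d !ltnS.
rewrite -[LHS]/(mps_comp f h (m + U_(j))%MM *+ (m j).+1).
rewrite (@mps_compE p) => [|a le_a]; last first.
  by rewrite mps_truncE // (leq_ltn_trans le_a) // ltS.
rewrite -[LHS]/(mps_deriv j (ev p) m) mmap_chain !mps_sumE.
apply: eq_bigr => i _; apply: mps_mul_congr => // a le_a.
rewrite (@mps_compE p^`M(i)) // => b le_b.
by rewrite mcoeff_deriv mps_truncE // ltS // (leq_trans le_b).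
Qed.

End Composition.

Section CompositionCongruence.
Context (k l : nat) (K : comNzRingType).
Implicit Types (f : {mpseries K[k]}) (h : 'I_k -> {mpseries K[l]}).

(** Series of [w]-order at least [d] form an ideal, and congruence modulo an ideal is preserved by
    powers, products and the finite sums giving each coefficient. *)
Lemma vanish_below_mps_compB (w : 'X_{1..l} -> nat)
    (wD : {morph w : a b / (a + b)%MM >-> (a + b)%N}) d f h h' :
  (forall i, vanish_below w d (h i - h' i)) ->
  vanish_below w d (mps_comp f h - mps_comp f h').
Proof.
move=> Hh m lt_m /=; rewrite -sumrB big1 // => a _; rewrite -mulrBr.
suff Ha : vanish_below w d (\prod_i h i ^+ (a : 'X_{1..k}) i -
                            \prod_i h' i ^+ (a : 'X_{1..k}) i).
  by rewrite -[X in _ * X]/((_ - _ : {mpseries K[l]}) m) Ha ?mulr0.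
have congrM (f1 f2 g1 g2 : {mpseries K[l]}) : vanish_below w d (f1 - f2) ->
    vanish_below w d (g1 - g2) -> vanish_below w d (f1 * g1 - f2 * g2).
  move=> Hf Hg; have -> : f1 * g1 - f2 * g2 = (f1 - f2) * g1 + f2 * (g1 - g2).
    by ring.
  by apply: vanish_belowD; [apply: vanish_belowMr | apply: vanish_belowMl].
have v11 : vanish_below w d (1 - 1 : {mpseries K[l]}).
  by rewrite subrr; apply: vanish_below0.
apply: (big_rec2 (fun p q : {mpseries K[l]} => vanish_below w d (p - q))) => //.
move=> i f1 f2 _; apply: (congrM); elim: ((a : 'X_{1..k}) i) => [|e IHe].
  by rewrite !expr0.
by rewrite !exprS; apply: (congrM).
Qed.

End CompositionCongruence.

(** Serves to compare [f] with a substitution that is the identity modulo [t]. The map [s] embeds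
    polynomials in series multiplicatively, so products of variables become monomials. *)
Lemma mps_comp_id n (K : comNzRingType) (f : {mpseries K[n]}) :
  mps_comp f (@mpsX n K) = f.
Proof.
pose s (p : {mpoly K[n]}) : {mpseries K[n]} := MPSeries (fun m => p@_m).
have s1 : s 1 = 1 by apply/mpseriesP => m /=; rewrite mcoeff1; case: eqP.
have sM : {morph s : p q / p * q}.
  by move=> p q; apply/mpseriesP => m; apply: mcoeffM_eq (ltnSn _) _ _.
have sX i : s 'X_i = mpsX i.
  by apply/mpseriesP => m /=; rewrite mcoeffX eq_sym.
have smon (a : 'X_{1..n}) : \prod_i mpsX i ^+ a i = s 'X_[a].
  rewrite mpolyXE_id (big_morph s sM s1); apply: eq_bigr => i _.
  by rewrite -sX; elim: (a i) => [|e IHe]; rewrite ?expr0 // !exprS sM IHe.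
apply/mpseriesP => m /=; rewrite -(mps_truncE f (ltnSn (mdeg m))).
rewrite /mps_trunc raddf_sum /=; apply: eq_bigr => a _.
by rewrite smon mcoeffZ.
Qed.

(** * Series in [z] and [t] *)

Definition tdeg (n : nat) (m : 'X_{1..n.+1}) : nat := m ord_max.

Section Weights.
Context (n : nat).

Lemma tdegD : {morph @tdeg n : a b / (a + b)%MM >-> (a + b)%N}.
Proof. by move=> a b; rewrite /tdeg mnmDE. Qed.

Lemma zdegD : {morph @zdeg n : a b / (a + b)%MM >-> (a + b)%N}.
Proof.
move=> a b; rewrite /zdeg -mdegD; congr mdeg.
by apply/mnmP => i; rewrite !(mnmDE, mnmE).
Qed.

Lemma zdegt : zdeg U_(ord_max : 'I_n.+1)%MM = 0%N.
Proof.
rewrite /zdeg mdegE big1 // => i _.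
by rewrite mnmE mnm1E (negPf (neq_lift _ _)).
Qed.

Lemma zdegz (i : 'I_n) : zdeg U_(lift ord_max i)%MM = 1%N.
Proof.
rewrite /zdeg -(mdeg1 i); congr mdeg; apply/mnmP => j.
by rewrite mnmE !mnm1E (inj_eq (@lift_inj _ _)).
Qed.

Lemma tdegz (i : 'I_n) : tdeg U_(lift ord_max i)%MM = 0%N.
Proof. by rewrite /tdeg mnm1E eq_sym (negPf (neq_lift _ _)). Qed.

Lemma zt_fun_z (T : Type) (u : 'I_n -> T) x i :
  zt_fun u x (lift ord_max i) = u i.
Proof. by rewrite /zt_fun liftK. Qed.

Lemma zt_fun_t (T : Type) (u : 'I_n -> T) x : zt_fun u x ord_max = x.
Proof. by rewrite /zt_fun unlift_none. Qed.

End Weights.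

(** The derivative multiplies this coefficient by the exponent [m i], which is invertible in
    characteristic zero. *)
Lemma mps_coef_deriv_eq0 n (K : numFieldType) (f : {mpseries K[n]}) i
    (m : 'X_{1..n}) :
  (0 < m i)%N -> mps_deriv i f (m - U_(i))%MM = 0 -> f m = 0.
Proof.
move=> mi_gt0 /=; have -> : (m - U_(i) + U_(i))%MM = m.
  by apply/mnmP => j; rewrite mnmDE mnmBE mnm1E subnK //; case: eqP => // <-.
by move/eqP; rewrite mulrn_eq0 => /= /eqP.
Qed.

Section SeriesZT.
Context (n : nat) (K : numFieldType).
Local Notation S := {mpseries K[n.+1]}.
Local Notation t := (tvar n K).
Local Notation z i := (mpsX (lift ord_max i) : {mpseries K[n.+1]}).
Local Notation Dz i := (mps_deriv (lift ord_max i)).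
Local Notation Dt := (mps_deriv ord_max).
Local Notation vanish_t := (vanish_below (@tdeg n)).
Implicit Types (f g : S) (B : 'I_n -> S).

Lemma vanish_t_deriv_z d i f : vanish_t d f -> vanish_t d (Dz i f).
Proof.
by move=> Hf m lt_m; rewrite /= Hf ?mul0rn // tdegD tdegz addn0.
Qed.

Lemma vanish_t_integrate d f :
  vanish_t 1 f -> vanish_t d (Dt f) -> vanish_t d.+1 f.
Proof.
move=> f1 Df m lt_m; have [m0|m_gt0] := posnP (tdeg m); first by rewrite f1 ?m0.
apply: (mps_coef_deriv_eq0 m_gt0); apply: Df.
by rewrite /tdeg mnmBE mnm1E eqxx subn1 -ltnS prednK.
Qed.

Lemma vanish_t_tvar : vanish_t 1 t.
Proof. by apply: vanish_below_mpsX; rewrite /tdeg mnm1E eqxx. Qed.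

Lemma vanish_t_eq0 f : (forall d, vanish_t d f) -> f = 0.
Proof. by move=> Hf; apply/mpseriesP => m; apply: (Hf (tdeg m).+1). Qed.

(** Formal uniqueness for differential systems in [t]: each integration gains one order in [t], so
    zero initial values force all orders to vanish. The family [V] lets the components of a system
    be treated together. *)
Lemma vanish_t_ode (I : Type) (V : I -> S) :
  (forall i, vanish_t 1 (V i)) ->
  (forall d, (forall i, vanish_t d (V i)) -> forall i, vanish_t d (Dt (V i))) ->
  forall i, V i = 0.
Proof.
move=> V1 HV i; apply: vanish_t_eq0 => d; elim: d i => [|d IHd] i; first by [].
by apply: vanish_t_integrate; [apply: V1 | apply: HV].
Qed.

(** With no pure power of [t] in [f], every monomial to be tested contains some [z_i], and its
    coefficient is recovered from the derivative in that variable. *)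
Lemma vanish_t_grad d f :
  vanish_below (@zdeg n) 1 f -> (forall i, vanish_t d (Dz i f)) -> vanish_t d f.
Proof.
move=> f0 Df m lt_m; have [m0|] := posnP (zdeg m); first by rewrite f0 ?m0.
rewrite lt0n mdeg_eq0 => nz_m.
have [i mi_gt0] : exists i : 'I_n, (0 < m (lift ord_max i))%N.
  apply/existsP; apply: contra_neqT nz_m => /existsPn Hm.
  apply/mnmP => i; rewrite mnmE mnm0E.
  by apply/eqP; rewrite -leqn0 leqNgt; apply: Hm.
apply: (mps_coef_deriv_eq0 mi_gt0); apply: Df.
by apply: leq_ltn_trans lt_m; rewrite /tdeg mnmBE leq_subr.
Qed.

Lemma grad_inj f :
  vanish_below (@zdeg n) 1 f -> (forall i, Dz i f = 0) -> f = 0.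
Proof.
move=> f0 Df; apply: vanish_t_eq0 => d; apply: vanish_t_grad => // i.
by rewrite Df; apply: vanish_below0.
Qed.

(** Turns the initial condition into a congruence modulo [t], the form used by the induction on the
    order in [t]. *)
Lemma at_t0P f (P : {mpseries K[n]}) : at_t0 f = P <-> vanish_t 1 (f - of_z P).
Proof.
split=> [<- m lt_m | Hf].
  have mt0 : m ord_max = 0%N by apply/eqP; rewrite -leqn0.
  rewrite /= mt0 eqxx; apply/eqP; rewrite subr_eq0; apply/eqP; congr (f _).
  apply/mnmP => j; rewrite mnmE; case: (unliftP ord_max j) => [i|] ->.
    by rewrite zt_fun_z mnmE.
  by rewrite zt_fun_t.
apply/mpseriesP => m.
pose m' : 'X_{1..n.+1} := [multinom zt_fun m 0%N j | j < n.+1].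
have mt0 : m' ord_max = 0%N by rewrite mnmE zt_fun_t.
have := Hf m'; rewrite /tdeg mt0 /= mt0 eqxx => /(_ isT)/eqP.
rewrite subr_eq0 => /eqP ->; congr (P _); apply/mnmP => i.
by rewrite !mnmE zt_fun_z.
Qed.

Lemma deriv_t_of_z (P : {mpseries K[n]}) : Dt (of_z P) = 0.
Proof. by apply/mpseriesP => m /=; rewrite mnmDE mnm1E eqxx addn1 mul0rn. Qed.

(** * The substitution of z + t B for z, with t fixed *)

Definition shift B : 'I_n.+1 -> S := zt_fun (fun i => z i + t * B i) t.

(** The factor [t] removes the constant term of [t * B i], whatever [B] is, so substitution is
    legitimate. *)
Lemma shift_vanish B j : vanish_below (@mdeg n.+1) 1 (shift B j).
Proof.
have Xv i : vanish_below (@mdeg n.+1) 1 (mpsX i : S).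
  by apply: vanish_below_mpsX; rewrite mdeg1.
case: (unliftP ord_max j) => [i|] ->; rewrite /shift ?zt_fun_t ?zt_fun_z;
  last exact: Xv.
by apply: vanish_belowD => //; apply: vanish_belowMr (Xv _); apply: mdegD.
Qed.

(** The composite is [z + t (B + A (z + t B))]; it equals [z] exactly when the bracket vanishes, by
    cancelling [t]. *)
Lemma zcomp_shiftP (A B : 'cV[S]_n) :
  zcomp (zvec n K + t *: A) (zvec n K + t *: B) = zvec n K <->
  forall i, mps_comp (A i 0) (shift (fun j => B j 0)) = - B i 0.
Proof.
set h := shift _; have h0 := shift_vanish (fun j => B j 0).
have E i : zcomp (zvec n K + t *: A) (zvec n K + t *: B) i 0 =
    z i + t * (B i 0 + mps_comp (A i 0) h).
  rewrite mxE (_ : zt_fun _ _ = h); last first.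
    rewrite /h /shift; congr zt_fun; apply: boolp.funext => j; by rewrite !mxE.
  rewrite !mxE mps_compD mps_compM // !mps_compX // /h.
  by rewrite {1 2}/shift zt_fun_z zt_fun_t; ring.
split=> [H i|H].
  have /eqP := E i; rewrite H mxE -subr_eq0 opprD addrA subrr sub0r oppr_eq0.
  by move=> /eqP/mpsXMI/eqP; rewrite addrC addr_eq0 => /eqP.
by apply/colP => i; rewrite E H subrr mulr0 addr0 mxE.
Qed.

Lemma comp_shift_t0 f B : vanish_t 1 (mps_comp f (shift B) - f).
Proof.
rewrite -{2}[f]mps_comp_id; apply: vanish_below_mps_compB; first exact: tdegD.
move=> j; case: (unliftP ord_max j) => [i|] ->.
  rewrite /shift zt_fun_z addrAC subrr add0r.
  by apply: vanish_belowMr vanish_t_tvar; apply: tdegD.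
by rewrite /shift zt_fun_t subrr; apply: vanish_below0.
Qed.

Lemma deriv_z_shift j f B : Dz j (mps_comp f (shift B)) =
  mps_comp (Dz j f) (shift B) +
  t * \sum_(k < n) mps_comp (Dz k f) (shift B) * Dz j (B k).
Proof.
rewrite (mps_comp_chain (shift_vanish B)) (bigD1_ord ord_max) //=.
rewrite {2}/shift zt_fun_t mps_derivX eq_sym (negPf (neq_lift _ _)) mulr0 add0r.
transitivity (\sum_(k < n) (mps_comp (Dz k f) (shift B) * (k == j)%:R
   + t * (mps_comp (Dz k f) (shift B) * Dz j (B k)))).
  apply: eq_bigr => k _; rewrite {2}/shift zt_fun_z raddfD /= mps_derivM.
  rewrite !mps_derivX (inj_eq (@lift_inj _ _)) eq_sym [_ == ord_max]eq_sym.
  by rewrite (negPf (neq_lift _ _)) mul0r add0r mulrDr mulrCA.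
rewrite big_split /= -mulr_sumr (bigD1 j) //= eqxx mulr1 big1 ?addr0 // => k.
by move=> /negPf->; rewrite mulr0.
Qed.

(** The second term comes from the motion of the point [z + t B], whose velocity is [B + t B_t]. *)
Lemma deriv_t_shift f B : Dt (mps_comp f (shift B)) =
  mps_comp (Dt f) (shift B) +
  \sum_(k < n) mps_comp (Dz k f) (shift B) * (B k + t * Dt (B k)).
Proof.
rewrite (mps_comp_chain (shift_vanish B)) (bigD1_ord ord_max) //=.
rewrite {2}/shift zt_fun_t mps_derivX eqxx mulr1; congr (_ + _).
apply: eq_bigr => k _; rewrite {2}/shift zt_fun_z raddfD /= mps_derivM.
by rewrite !mps_derivX eqxx (negPf (neq_lift _ _)) add0r mul1r.
Qed.

End SeriesZT.

(** * The Burgers equation *)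

Section Burgers.
Context (n : nat) (K : numFieldType).
Local Notation S := {mpseries K[n.+1]}.
Local Notation t := (tvar n K).
Local Notation Dz i := (mps_deriv (lift ord_max i)).
Local Notation Dt := (mps_deriv ord_max).
Local Notation vanish_t := (vanish_below (@tdeg n)).
Implicit Types (q : S) (A B M N : 'I_n -> S) (P : {mpseries K[n]}).

Definition burgers N i := Dt (N i) - \sum_(k < n) N k * Dz k (N i).

(** The Burgers residual of a gradient is the gradient of the Cauchy residual: mixed derivatives
    commute, and differentiating the squares gives the factor 2 that cancels [2^-1]. *)
Lemma burgers_grad q i : burgers (fun k => Dz k q) i =
  Dz i (Dt q - 2^-1 *: \sum_(k < n) Dz k q * Dz k q).
Proof.
rewrite /burgers raddfB /= mps_derivZ mps_derivC; congr (_ - _).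
rewrite raddf_sum scaler_sumr; apply: eq_bigr => k _ /=.
rewrite mps_derivM [Dz i _ * _]mulrC -mulr2n -scaler_nat scalerA.
by rewrite mulVf ?pnatr_eq0 // scale1r mps_derivC.
Qed.

(* The defect [V = N - M (z + t N)] is transported by the field [N] up to the
   failure of [N] to solve the Burgers equation. *)
Lemma transport_defect M N i (V := fun j => N j - mps_comp (M j) (shift N)) :
  (forall j, Dt (M j) = 0) ->
  Dt (V i) - \sum_(k < n) N k * Dz k (V i) =
  burgers N i -
  t * \sum_(l < n) mps_comp (Dz l (M i)) (shift N) * burgers N l.
Proof.
move=> DtM; pose c l := mps_comp (Dz l (M i)) (shift N).
have -> : Dt (V i) = Dt (N i) - \sum_l c l * (N l + t * Dt (N l)).
  by rewrite raddfB /= deriv_t_shift // DtM mps_comp0 add0r.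
have -> : \sum_k N k * Dz k (V i) = \sum_k N k * Dz k (N i) - \sum_k c k * N k
    - t * \sum_l c l * \sum_k N k * Dz k (N l).
  transitivity (\sum_k (N k * Dz k (N i) - c k * N k
      - t * \sum_l c l * (N k * Dz k (N l)))).
    apply: eq_bigr => k _; rewrite raddfB /= deriv_z_shift -/(c k).
    rewrite mulrBr mulrDr opprD addrA [N k * c k]mulrC mulrCA.
    congr (_ - t * _).
    by rewrite mulr_sumr; apply: eq_bigr => l _; rewrite mulrCA.
  rewrite !sumrB -mulr_sumr exchange_big /=; congr (_ - t * _).
  by apply: eq_bigr => l _; rewrite mulr_sumr.
(* The terms [c l * N l] from the two derivatives cancel; the rest carries a factor [t] and groups
   into the Burgers residuals. *)
transitivity (burgers N i - t * (\sum_l c l * Dt (N l)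
    - \sum_l c l * \sum_k N k * Dz k (N l))); last first.
  by congr (_ - t * _); rewrite -sumrB; apply: eq_bigr => l _; rewrite -mulrBr.
have -> : \sum_l c l * (N l + t * Dt (N l)) =
    \sum_l c l * N l + t * \sum_l c l * Dt (N l).
  by rewrite mulr_sumr -big_split; apply: eq_bigr => l _ /=; ring.
by rewrite /burgers; ring.
Qed.

Lemma burgers_eq0_of_inverse M N :
  (forall i, Dt (M i) = 0) ->
  (forall i, mps_comp (M i) (shift N) = N i) ->
  forall i, burgers N i = 0.
Proof.
move=> DtM MN i.
have E j : burgers N j =
    t * \sum_(l < n) mps_comp (Dz l (M j)) (shift N) * burgers N l.
  apply/eqP; rewrite -subr_eq0 -transport_defect // MN subrr raddf0.
  rewrite big1 ?subr0 //.
  by move=> k _; rewrite raddf0 mulr0.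
apply: vanish_t_eq0 => d; elim: d i => [|d IHd] i; first by [].
(* Each use of [E] gains one factor [t] over the order already known for all components. *)
rewrite E -[d.+1]add1n; apply: vanish_belowM (@vanish_t_tvar n K) _;
  first exact: tdegD.
by apply: vanish_below_sum => l _; apply: vanish_belowMl; [apply: tdegD|].
Qed.

(** The defect vanishes at [t = 0] and is now transported exactly by [N]; derivatives in [z] do not
    lower the order in [t], so [vanish_t_ode] applies. *)
Lemma right_inverse_of_burgers M N :
  (forall i, Dt (M i) = 0) -> (forall i, burgers N i = 0) ->
  (forall i, vanish_t 1 (N i - M i)) ->
  forall i, mps_comp (M i) (shift N) = N i.
Proof.
move=> DtM BN NM i; apply/esym/eqP; rewrite -subr_eq0; apply/eqP; move: i.
apply: vanish_t_ode => [i|d IHd i].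
  have -> : N i - mps_comp (M i) (shift N) =
      (N i - M i) - (mps_comp (M i) (shift N) - M i) by ring.
  by apply: vanish_belowB => //; apply: comp_shift_t0.
have := transport_defect N i DtM.
rewrite BN [X in _ = _ - _ * X]big1 => [|l _]; last by rewrite BN mulr0.
rewrite mulr0 subr0 => /eqP; rewrite subr_eq0 => /eqP ->.
apply: vanish_below_sum => k _; apply: vanish_belowMl; first exact: tdegD.
exact/vanish_t_deriv_z.
Qed.

(** The point [z - t M] moves with velocity [-M], while Burgers gives [N_t = (DN) N] along it; the
    two contributions combine into a linear equation for the defect [N (z - t M) - M]. *)
Lemma left_inverse_of_burgers M N :
  (forall i, Dt (M i) = 0) -> (forall i, burgers N i = 0) ->
  (forall i, vanish_t 1 (N i - M i)) ->
  forall i, mps_comp (N i) (shift (fun j => - M j)) = M i.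
Proof.
move=> DtM BN NM i; set h := shift _.
apply/eqP; rewrite -subr_eq0; apply/eqP; move: i.
have h0 : forall j, vanish_below (@mdeg n.+1) 1 (h j) by apply: shift_vanish.
apply: vanish_t_ode => [i|d IHd i].
  have -> : mps_comp (N i) h - M i = (mps_comp (N i) h - N i) + (N i - M i).
    by ring.
  by apply: vanish_belowD => //; apply: comp_shift_t0.
suff -> : Dt (mps_comp (N i) h - M i) =
    \sum_(k < n) mps_comp (Dz k (N i)) h * (mps_comp (N k) h - M k).
  by apply: vanish_below_sum => k _; apply: vanish_belowMl; [apply: tdegD|].
rewrite raddfB /= DtM subr0 deriv_t_shift.
have /eqP := BN i; rewrite subr_eq0 => /eqP ->.
rewrite mps_comp_sum -big_split; apply: eq_bigr => k _ /=.
by rewrite mps_compM // raddfN /= DtM oppr0 mulr0 addr0; ring.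
Qed.

(** * Orders in z of the terms of the Cauchy problem *)

Lemma vanish_z_of_z P : leq_order 2%N (mps_order (@mdeg n) P) ->
  vanish_below (@zdeg n) 2 (of_z P).
Proof. by move=> /leq_mps_orderP oP m /oP Pm /=; case: eqP. Qed.

Lemma vanish_z_deriv_z d i q :
  vanish_below (@zdeg n) d.+1 q -> vanish_below (@zdeg n) d (Dz i q).
Proof.
by move=> Hq m lt_m /=; rewrite Hq ?mul0rn // zdegD zdegz addn1.
Qed.

Lemma vanish_z_deriv_t d q :
  vanish_below (@zdeg n) d q -> vanish_below (@zdeg n) d (Dt q).
Proof. by move=> Hq m lt_m /=; rewrite Hq ?mul0rn // zdegD zdegt addn0. Qed.

Lemma vanish_z_bilin d q : vanish_below (@zdeg n) d.+1 q ->
  vanish_below (@zdeg n) d (\sum_(k < n) Dz k q * Dz k q).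
Proof.
move=> Hq; apply: vanish_below_sum => k _.
by apply: vanish_belowMr; [apply: zdegD | apply: vanish_z_deriv_z].
Qed.

Lemma bilin_grad q :
  bilin (grad_z q) (grad_z q) = \sum_(k < n) Dz k q * Dz k q.
Proof. by apply: eq_bigr => k _; rewrite !mxE. Qed.

Lemma cauchy_solution_unique P q q' :
  cauchy_solution P q -> cauchy_solution P q' -> q = q'.
Proof.
move=> [Eq /at_t0P q0] [Eq' /at_t0P q0'].
apply/eqP; rewrite -subr_eq0; apply/eqP.
apply: (@vanish_t_ode n K unit (fun=> q - q')) tt => [_|d /(_ tt) IHd _].
  have -> : q - q' = (q - of_z P) - (q' - of_z P) by ring.
  exact: vanish_belowB.
rewrite raddfB /= -/(deriv_t q) -/(deriv_t q') Eq Eq' !bilin_grad.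
rewrite -scalerBr -sumrB; apply/vanish_belowZ/vanish_below_sum => k _.
(* A difference of squares makes the equation linear in [q - q']. *)
have -> : Dz k q * Dz k q - Dz k q' * Dz k q' =
    (Dz k q + Dz k q') * Dz k (q - q') by rewrite raddfB /=; ring.
by apply: vanish_belowMl; [apply: tdegD | apply: vanish_t_deriv_z].
Qed.

Lemma zinverse_gradP q p :
  zinverse (zvec n K + t *: grad_z q) (zvec n K - t *: grad_z p) <->
  (forall i, mps_comp (Dz i q) (shift (fun j => - Dz j p)) = Dz i p) /\
  (forall i, mps_comp (Dz i p) (shift (fun j => Dz j q)) = Dz i q).
Proof.
have gradE f : (fun j => grad_z f j 0) = fun j => Dz j f.
  by apply: boolp.funext => j; rewrite mxE.
have gradNE : (fun j => (- grad_z p) j 0) = fun j => - Dz j p.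
  by apply: boolp.funext => j; rewrite !mxE.
have compN f B : mps_comp (- f) (shift B) = - mps_comp f (shift B).
  by rewrite -sub0r mps_compB mps_comp0 sub0r.
rewrite /zinverse -scalerN.
split=> [[/zcomp_shiftP H2 /zcomp_shiftP H1]|[H1 H2]]; split.
- by move=> i; have := H1 i; rewrite gradNE !mxE opprK.
- move=> i; have := H2 i; rewrite gradE !mxE compN.
  exact: oppr_inj.
- by apply/zcomp_shiftP => i; rewrite gradE !mxE compN H2.
- by apply/zcomp_shiftP => i; rewrite gradNE !mxE opprK H1.
Qed.

End Burgers.

Theorem theorem3p6 (R : realType) (n : nat) (n_gt0 : (0 < n)%N)
    (Q : {mpseries R[i][n.+1]}) (P : {mpseries R[i][n]})
    (oQ : leq_order 2%N (mps_order (@zdeg n) Q))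
    (oP : leq_order 2%N (mps_order (@mdeg n) P)) :
  zinverse (zvec n R[i] + tvar n R[i] *: grad_z Q)
           (zvec n R[i] - tvar n R[i] *: grad_z (of_z P))
  <-> unique (cauchy_solution P) Q.
Proof.
pose M i := mps_deriv (lift ord_max i) (of_z P).
pose N i := mps_deriv (lift ord_max i) Q.
have DtM i : mps_deriv ord_max (M i) = 0.
  by rewrite mps_derivC deriv_t_of_z raddf0.
have zQ : vanish_below (@zdeg n) 2 Q by apply/leq_mps_orderP.
have zP := vanish_z_of_z oP.
have zle (f : {mpseries R[i][n.+1]}) :
    vanish_below (@zdeg n) 2 f -> vanish_below (@zdeg n) 1 f.
  by move=> Hf m lt_m; apply/Hf/ltnW.
split=> [/zinverse_gradP[_ MN] | [[EQ /at_t0P Q0] _]]; last first.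
  have BN i : burgers N i = 0.
    by rewrite burgers_grad -bilin_grad -EQ subrr raddf0.
  have NM i : vanish_below (@tdeg n) 1 (N i - M i).
    by rewrite -raddfB; apply: vanish_t_deriv_z.
  apply/zinverse_gradP; split.
    exact: left_inverse_of_burgers.
  exact: right_inverse_of_burgers.
(* Uniqueness holds for any solution, so only the equation and the initial value remain. *)
suff SQ : cauchy_solution P Q.
  by split=> // Q' SQ'; apply: cauchy_solution_unique SQ SQ'.
split.
  (* The Burgers equation only makes the gradient of the Cauchy residual vanish; the order in [z]
     excludes a leftover series in [t] alone. *)
  apply/eqP; rewrite bilin_grad -subr_eq0; apply/eqP/grad_inj.
    apply: vanish_belowB; first exact/vanish_z_deriv_t/zle.
    exact/vanish_belowZ/vanish_z_bilin.
  by move=> i; rewrite -burgers_grad; apply: burgers_eq0_of_inverse DtM MN i.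
(* Modulo [t] the relation [N = M (z + t N)] reads [N = M], and the gradients determine [Q] and [P]
   since neither has terms free of [z]. *)
apply/at_t0P/vanish_t_grad; first by apply: vanish_belowB; apply: zle.
by move=> i; rewrite raddfB /= -MN; apply: comp_shift_t0.
Qed.
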